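(* Let $n\ge 2$ be an integer and let $G$ be a simple graph. Then $G$ is isomorphic to the path $P_n$ on $n$ vertices if and only if $$da(G;x,y) = 2xy^{n-1} + (n-2)xy^{n-2} + y^{n}\sum_{i=2}^{n-1}(n-i+1)x^{i} + x^{n}y^{n+1}.$$
   Context: All graphs are finite, simple and have at least one vertex. For a graph $G$, $S\subseteq V(G)$ and $u\in V(G)$, let $\bar S=V(G)\setminus S$, let $\delta_S(u)=|\{v\in S:\{u,v\}\in E(G)\}|$, and let $G[S]$ be the subgraph induced by $S$. The defensive alliance polynomial of $G$ is $$da(G;x,y)=\sum_{S} x^{|S|}\,y^{f_y(S)},\qquad f_y(S)=\min_{u\in S}\bigl(\delta_S(u)-\delta_{\bar S}(u)+|V(G)|\bigr),$$ where the sum runs over all non-empty $S\subseteq V(G)$ such that $G[S]$ is connected (single-vertex graphs are connected). *)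

(* Defs.v *)
From HB Require Import structures.
From mathcomp Require Import all_boot all_order all_algebra.

Set Implicit Arguments.
Unset Strict Implicit.
Unset Printing Implicit Defensive.

Import Order.TTheory GRing.Theory Num.Theory.

(* The empty vertex set is allowed here; nonemptiness of a graph is an explicit
   hypothesis [0 < #|G|] where it is assumed. *)
Record sgraph := SGraph {
  vertex :> finType;
  adj : rel vertex;
  adj_sym : symmetric adj;
  adj_irr : irreflexive adj }.

Definition isomorphic (G H : sgraph) : Prop :=
  exists f : G -> H, bijective f /\ forall u v : G, adj (f u) (f v) = adj u v.

Section PathGraph.
Variable n : nat.

Definition path_adj : rel 'I_n :=
  fun i j => (i.+1 == j :> nat) || (j.+1 == i :> nat).

Lemma path_adj_sym : symmetric path_adj.
Proof. by move=> i j; rewrite /path_adj orbC. Qed.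

Lemma path_adj_irr : irreflexive path_adj.
Proof. by move=> i; rewrite /path_adj orbb gtn_eqF. Qed.

Definition path_graph : sgraph := SGraph path_adj_sym path_adj_irr.
End PathGraph.

Definition connected (G : sgraph) : bool :=
  [forall u : G, forall v : G, connect (@adj G) u v].

Section Alliance.
Variable G : sgraph.
Implicit Types (S : {set G}) (u : G).

Definition induced_adj S : rel {x : G | x \in S} :=
  fun a b => adj (val a) (val b).

Lemma induced_adj_sym S : symmetric (@induced_adj S).
Proof. by move=> a b; apply: adj_sym. Qed.

Lemma induced_adj_irr S : irreflexive (@induced_adj S).
Proof. by move=> a; apply: adj_irr. Qed.

Definition induced S : sgraph :=
  SGraph (@induced_adj_sym S) (@induced_adj_irr S).

Definition delta S u : nat := #|[set v in S | adj u v]|.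

(* The subtraction is performed last so that it never truncates: see [exponentE]. *)
Definition exponent S u : nat := (delta S u + #|G| - delta (~: S) u)%N.

(* The default value #|G|.*2 of the iterated minimum bounds all the exponents
   and is irrelevant for nonempty S: see [fy_le] and [fy_attained]. *)
Definition fy S : nat := \big[minn/#|G|.*2]_(u in S) exponent S u.

Lemma exponentE S u :
  Posz (exponent S u) = (Posz (delta S u) - Posz (delta (~: S) u) + Posz #|G|)%R.
Proof.
rewrite /exponent -subzn; first by rewrite PoszD addrAC.
by apply: leq_trans (max_card _) (leq_addl _ _).
Qed.

Lemma exponent_le S u : exponent S u <= #|G|.*2.
Proof.
by rewrite -addnn (leq_trans (leq_subr _ _)) // leq_add2r max_card.
Qed.

Lemma fy_le S u : u \in S -> fy S <= exponent S u.
Proof.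
move=> uS; rewrite /fy; have := mem_index_enum u.
elim: (index_enum _) => [|v s IHs]; first by rewrite in_nil.
rewrite inE big_cons => /predU1P[<-|/IHs le_s]; first by rewrite uS geq_minl.
by case: ifP => // _; rewrite geq_min le_s orbT.
Qed.

Lemma fy_attained S : S != set0 -> exists2 u, u \in S & fy S = exponent S u.
Proof.
case/set0Pn=> u0 u0S.
have [|[v vS ->]] : fy S = #|G|.*2 \/ exists2 u, u \in S & fy S = exponent S u.
- rewrite /fy; elim/big_ind: _ => [|a b|u uS]; [by left| |by right; exists u].
  by rewrite /minn; case: ifP.
- move=> fE; exists u0 => //; apply/eqP.
  by rewrite eqn_leq fy_le //= fE exponent_le.
- by exists v.
Qed.

(* x is the outer variable 'X and y is the inner variable 'Y = 'X%:P. *)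
Definition da : {poly {poly int}} :=
  (\sum_(S : {set G} | (S != set0) && connected (induced S))
     'X^#|S| * 'Y ^+ fy S)%R.
End Alliance.

(* Main.v *)
Require Import Defs.
From HB Require Import structures.
From mathcomp Require Import all_boot all_order all_algebra zify.

Set Implicit Arguments.
Unset Strict Implicit.
Unset Printing Implicit Defensive.

Import Order.TTheory GRing.Theory Num.Theory.
Local Open Scope ring_scope.

(** Connected vertex sets are transported by isomorphisms, and those of [P_n]
    are its intervals, whose exponents are read off from their two ends; this
    gives the polynomial of [P_n]. Conversely, since a singleton [{u}] has
    exponent [|V| - deg u], the coefficient of [x] in [da G] is the generating
    function of the degrees: setting [y = 1] gives [|V| = n], and its powers of
    [y] show that all degrees are 1 or 2 and that some vertex has degree 1. The
    coefficient of [x^n] shows that [G] is connected. A maximal path from a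
    vertex of degree 1 then absorbs all the neighbors of its vertices, hence is
    spanning, and the degree bound leaves no chord. *)

(** * Connected sets, minimal exponents and coefficients of the polynomial *)

Section Connectivity.
Variable G : sgraph.
Implicit Types (S A : {set G}) (u v : G).

(* Connectivity by cuts, a form without subtypes that is easy to transport. *)
Lemma connected_inducedP S :
  reflect (forall A, A \subset S -> A != set0 ->
             (forall u v, u \in A -> v \in S -> adj u v -> v \in A) -> A = S)
          (connected (induced S)).
Proof.
apply: (iffP forallP) => [conS A sAS /set0Pn[a aA] clA | cutS u].
- apply/eqP; rewrite eqEsubset sAS; apply/subsetP => b bS.
  have aS := subsetP sAS a aA.
  have /forallP/(_ (exist _ b bS : induced S)) := conS (exist _ a aS).
  have symS : connect_sym (@adj (induced S)).
    by apply: sym_connect_sym; apply: adj_sym.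
  have clA' : closed (@adj (induced S)) [pred x : induced S | val x \in A].
    by apply: intro_closed => // x y xy xA; apply: clA xA (valP y) xy.
  by move=> /(closed_connect clA'); rewrite !inE /= aA.
(* [A] is the component of [u]; the cut condition forces it to be all of [S]. *)
- apply/forallP=> v; pose A := val @: [set w | connect (@adj (induced S)) u w].
  have AS : A = S.
    apply: cutS.
    + by apply/subsetP=> _ /imsetP[w _ ->]; apply: valP.
    + by apply/set0Pn; exists (val u); apply/imsetP; exists u; rewrite ?inE.
    + move=> x y /imsetP[w]; rewrite inE => uw -> {x} yS wy.
      apply/imsetP; exists (exist _ y yS) => //; rewrite inE.
      exact: connect_trans uw (connect1 _).
  have : val v \in A by rewrite AS; apply: valP.
  by case/imsetP=> w; rewrite inE => uw /val_inj ->.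
Qed.

Lemma connected_set1 u : connected (induced [set u]).
Proof.
apply/connected_inducedP=> A sA nA _; apply/eqP.
by rewrite eqEcard sA cards1 card_gt0.
Qed.

Lemma delta_set1 u : delta [set u] u = 0%N.
Proof.
apply/eqP; rewrite cards_eq0; apply/eqP/setP=> v; rewrite !inE.
by case: eqP => // ->; rewrite adj_irr.
Qed.

Lemma delta_setC1 u : delta (~: [set u]) u = #|[set v | adj u v]|.
Proof.
apply: eq_card => v; rewrite !inE; case: eqP => //= ->.
by rewrite adj_irr.
Qed.

(** Certifies a minimum by a witness and a lower bound, so that the default value in [fy] never has
    to be handled. *)
Lemma fy_eq S u e : u \in S -> exponent S u = e ->
  (forall v, v \in S -> (e <= exponent S v)%N) -> fy S = e.
Proof.
move=> uS <- min_u; have [|v vS fE] := @fy_attained G S.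
  by apply/set0Pn; exists u.
by apply/eqP; rewrite eqn_leq fy_le //= fE min_u.
Qed.

Lemma fy_set1 u : fy [set u] = (#|G| - #|[set v | adj u v]|)%N.
Proof.
apply: (@fy_eq _ u); first by rewrite inE.
  by rewrite /exponent delta_set1 delta_setC1.
by move=> v /set1P ->; rewrite /exponent delta_set1 delta_setC1.
Qed.

Lemma coef_da k :
  (da G)`_k = \sum_(S : {set G} | [&& S != set0, connected (induced S)
                                    & #|S| == k]) 'X^(fy S).
Proof.
rewrite /da coef_sum [RHS]big_mkcond [LHS]big_mkcond /=.
apply: eq_bigr => S _; case: (S != set0) => //=; case: connected => //=.
rewrite -rmorphXn /= coefMC coefXn eq_sym.
by case: eqP; rewrite ?mul1r ?mul0r.
Qed.

Lemma coef1_da : (da G)`_1 = \sum_(u : G) 'X^(#|G| - #|[set v | adj u v]|).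
Proof.
rewrite coef_da; under [RHS]eq_bigr => u _ do rewrite -fy_set1.
rewrite -(big_imset (h := set1) (fun S => 'X^(fy S))) /=; last first.
  by move=> u v _ _; apply: set1_inj.
apply: eq_bigl => S; apply/and3P/imsetP=> [[_ _ /cards1P[u ->]]|[u _ ->]].
  by exists u.
by rewrite connected_set1 cards1 -card_gt0 cards1.
Qed.

End Connectivity.

(** * Invariance under isomorphism *)

Lemma da_isomorphic (G H : sgraph) : isomorphic G H -> da G = da H.
Proof.
case=> f [bij_f adj_f]; have inj_f := bij_inj bij_f.
have [g fK gK] := bij_f.
have imK (S : {set H}) : f @: (f @^-1: S) = S.
  apply/setP=> v; rewrite -[v]gK mem_imset // inE //.
have imC (S : {set G}) : ~: (f @: S) = f @: (~: S).
  by apply/setP=> v; rewrite -[v]gK inE !mem_imset // inE.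
have cardGH : #|G| = #|H| := bij_eq_card bij_f.
have delta_f (S : {set G}) u : delta (f @: S) (f u) = delta S u.
  rewrite /delta -(card_imset (mem [set v in S | adj u v]) inj_f).
  apply: eq_card => v; rewrite -[v]gK !inE !mem_imset // !inE adj_f //.
have fy_f (S : {set G}) : fy (f @: S) = fy S.
  have exp_f u : exponent (f @: S) (f u) = exponent S u.
    by rewrite /exponent imC !delta_f cardGH.
  (* On the empty set both minima are the default value, which depends only on the common order of
     the two graphs. *)
  have [->|/fy_attained[u uS fE]] := eqVneq S set0.
    by rewrite imset0 /fy !big_set0 cardGH.
  apply: (@fy_eq _ _ (f u)); rewrite ?mem_imset ?exp_f //.
  by move=> _ /imsetP[v vS ->]; rewrite exp_f fy_le.
have con_f (S : {set G}) : connected (induced (f @: S)) = connected (induced S).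
  apply/connected_inducedP/connected_inducedP=> cutS A sA nA clA.
  - apply: (imset_inj inj_f); apply: cutS; first exact: imsetS.
      by rewrite imset_eq0.
    move=> u v; rewrite -[u]gK -[v]gK !mem_imset // adj_f; exact: clA.
  - suff <- : f @^-1: A = S by rewrite imK.
    apply: cutS.
    + by apply/subsetP=> u; rewrite inE => /(subsetP sA); rewrite mem_imset.
    + by apply: contraNneq nA => A0; rewrite -[A]imK A0 imset0.
    + move=> u v; rewrite !inE => uA vS uv; apply: clA uA _ _.
        by rewrite mem_imset.
      by rewrite adj_f.
rewrite /da [RHS](reindex_onto (fun S : {set G} => f @: S)
                               (fun S : {set H} => f @^-1: S)) /=.
  apply: eq_big => S.
    rewrite imset_eq0 con_f; have -> : f @^-1: (f @: S) = S; last by rewrite eqxx andbT.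
    by apply/setP=> u; rewrite inE mem_imset.
  by rewrite fy_f card_imset.
by move=> S _; apply: imK.
Qed.

(** * The polynomial of the path *)

Section Path.
Variable n : nat.
Implicit Types P : pred nat.

(** [P] lives on [nat] so that it can be evaluated at both candidate neighbors without bound proofs;
    the guards discard a candidate that falls off the path. *)
Lemma delta_path P (k : path_graph n) :
  delta [set v : path_graph n | P v] k
    = ((0 < k) && P k.-1 + (k.+1 < n) && P k.+1)%N.
Proof.
have count1 m : (\sum_(v < n) ((v == m :> nat) && P v) = ((m < n) && P m))%N.
  case: ltnP => /= mn.
    rewrite (bigD1 (Ordinal mn)) //= eqxx big1 ?addn0 // => v /eqP vm.
    by case: eqP => //= vE; case: vm; apply: ord_inj.
  by rewrite big1 // => v _; rewrite ltn_eqF // (leq_trans (ltn_ord v)).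
have kn := ltn_ord k.
rewrite /delta -sum1_card big_mkcond /=.
(* Adjacency splits into a left and a right neighbor. The guard is essential: [0.-1] is [0], so
   vertex 0 would otherwise count itself. *)
rewrite (eq_bigr (fun v : 'I_n => ((0 < k)%N && ((v == k.-1 :> nat) && P v)
                                  + ((v == k.+1 :> nat) && P v))%N)); last first.
  move=> v _; rewrite !inE /adj /= /path_adj.
  case: (P v); rewrite ?andbF //= ?andbT.
  by case: ifP => /=; lia.
rewrite big_split /= count1; congr addn.
case: posnP => k0 /=; first by rewrite big1.
by rewrite count1; case: (P _); lia.
Qed.

Definition interval a i : {set path_graph n} :=
  [set k : path_graph n | (a <= k < a + i)%N].

Lemma card_interval a i : (a + i <= n)%N -> #|interval a i| = i.
Proof.
move=> ain; rewrite -[RHS]card_ord.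
have lt_h (j : 'I_i) : (a + j < n)%N by have := ltn_ord j; lia.
pose h j : path_graph n := Ordinal (lt_h j).
have inj_h : injective h by move=> j j' /(congr1 (@nat_of_ord _)) /= /addnI /ord_inj.
rewrite -(card_codom inj_h); apply: eq_card => k; rewrite inE.
apply/idP/codomP=> [/andP[ak kai]|[j ->]] /=; last first.
  by have := ltn_ord j; lia.
have ji : (k - a < i)%N by lia.
by exists (Ordinal ji); apply: ord_inj => /=; lia.
Qed.

(** From any vertex [m] of a closed part [A], membership propagates one step at a time to both ends
    of the interval. *)
Lemma connected_interval a i : connected (induced (interval a i)).
Proof.
apply/connected_inducedP=> A sA /set0Pn[m mA] clA.
apply/eqP; rewrite eqEsubset sA; apply/subsetP=> k; rewrite inE => /andP[ak kai].
have := subsetP sA m mA; rewrite inE => /andP[am mai].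
have up (v : nat) (vn : (v < n)%N) : (m <= v < a + i)%N ->
    (Ordinal vn : path_graph n) \in A.
  elim: v vn => [|v IHv] vn mv.
    by rewrite (_ : Ordinal vn = m) //; apply: ord_inj => /=; lia.
  have [vm|mv'] := eqVneq v.+1 (nat_of_ord m).
    by rewrite (_ : Ordinal vn = m) //; apply: ord_inj.
  have vn' : (v < n)%N by lia.
  apply: (clA (Ordinal vn')); first by apply: IHv; lia.
    by rewrite inE /=; lia.
  by rewrite /adj /= /path_adj /= eqxx.
(* Downwards, the induction is on the distance [d] from [v] to [m]. *)
have down d (v : nat) (vn : (v < n)%N) : (v + d = m)%N -> (a <= v)%N ->
    (Ordinal vn : path_graph n) \in A.
  elim: d v vn => [|d IHd] v vn vm av.
    by rewrite (_ : Ordinal vn = m) //; apply: ord_inj => /=; lia.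
  have vn' : (v.+1 < n)%N by have := ltn_ord m; lia.
  apply: (clA (Ordinal vn')); first by apply: IHd; lia.
    by rewrite inE /=; lia.
  by rewrite /adj /= /path_adj /= eqxx orbT.
have kE : k = Ordinal (ltn_ord k) by apply: ord_inj.
case: (leqP m k) => mk; rewrite kE; first by apply: up; lia.
by apply: (down (m - k)%N); lia.
Qed.

Lemma connected_is_interval (S : {set path_graph n}) :
  S != set0 -> connected (induced S) ->
  exists2 a, (a + #|S| <= n)%N & S = interval a #|S|.
Proof.
move=> /set0Pn[s sS] /connected_inducedP cutS.
have [a aS mina] := arg_minnP (fun k : path_graph n => k : nat) sS.
have [b bS maxb] := arg_maxnP (fun k : path_graph n => k : nat) sS.
have {}aS : a \in S := aS; have {}bS : b \in S := bS.
have ab : (a <= b)%N := mina b bS.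
have bn := ltn_ord b.
have SE : S = interval a (b.+1 - a).
  apply/setP=> m; rewrite inE; apply/idP/idP=> [mS|/andP[am mb]].
    by have := mina m mS; have := maxb m mS; lia.
  apply/negPn/negP=> mS.
  have nm k : k \in S -> (k : nat) <> m by move=> kS /ord_inj km; rewrite -km kS in mS.
  (* An edge moves by one position, so it cannot jump over the missing [m]: the part of [S] below
     [m] is closed. It contains the minimum [a] but not the maximum [b]. *)
  pose A := [set k in S | (k < m)%N].
  have AS : A = S.
    apply: cutS.
    - by apply/subsetP=> k; rewrite inE => /andP[].
    - by apply/set0Pn; exists a; rewrite inE aS /=; have := nm a aS; lia.
    - move=> u v; rewrite !inE => /andP[uS um] vS; rewrite vS /=.
      by rewrite /adj /= /path_adj; have := nm v vS; lia.
  by have := bS; rewrite -AS inE bS /=; lia.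
have cardS : #|S| = (b.+1 - a)%N by rewrite {1}SE card_interval //; lia.
by exists (a : nat); rewrite cardS //; lia.
Qed.

Lemma delta_interval a i (k : path_graph n) : (a + i <= n)%N -> k \in interval a i ->
  delta (interval a i) k = ((a < k) + (k.+1 < a + i))%N.
Proof.
by rewrite inE => ain kai; rewrite (delta_path (fun k : nat => a <= k < a + i)%N); lia.
Qed.

Lemma delta_intervalC a i (k : path_graph n) : (a + i <= n)%N -> k \in interval a i ->
  delta (~: interval a i) k
    = ((0 < k) && (k == a :> nat) + (k.+1 < n) && (k.+1 == a + i))%N.
Proof.
rewrite inE => ain kai.
rewrite (_ : ~: _ = [set v : path_graph n | ~~ (a <= v < a + i)%N]); last first.
  by apply/setP=> v; rewrite !inE.
rewrite (delta_path (fun k : nat => ~~ (a <= k < a + i)%N)); lia.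
Qed.

Lemma exponent_interval a i (k : path_graph n) : (a + i <= n)%N -> k \in interval a i ->
  exponent (interval a i) k =
    ((a < k) + (k.+1 < a + i) + n -
     ((0 < k) && (k == a :> nat) + (k.+1 < n) && (k.+1 == a + i)))%N.
Proof.
by move=> ain kS; rewrite /exponent delta_interval // delta_intervalC // card_ord.
Qed.

Lemma fy_interval1 a : (a < n)%N ->
  fy (interval a 1) = (n - (0 < a) - (a.+1 < n))%N.
Proof.
move=> an; have aS : (Ordinal an : path_graph n) \in interval a 1.
  by rewrite inE /=; lia.
have an1 : (a + 1 <= n)%N by lia.
apply: (fy_eq aS) => [|v vS]; rewrite exponent_interval //=; first lia.
by move: vS; rewrite inE; lia.
Qed.

(** With at least two vertices, an end has one neighbor inside and at most one outside, while an
    inner vertex has two inside. The minimum is thus reached at an end with a neighbor outside,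
    which exists since the interval is proper. *)
Lemma fy_interval a i : (1 < i < n)%N -> (a + i <= n)%N -> fy (interval a i) = n.
Proof.
move=> i1n ain.
have [u uS uE] : exists2 u, u \in interval a i & exponent (interval a i) u = n.
  (* The left end works unless it is vertex 0; then the right end [i.-1] works, because [i < n]. *)
  have [a0|a_gt0] := posnP a; last first.
    have an : (a < n)%N by lia.
    have aS : (Ordinal an : path_graph n) \in interval a i by rewrite inE /=; lia.
    by exists (Ordinal an) => //; rewrite exponent_interval //=; lia.
  have an : (i.-1 < n)%N by lia.
  have aS : (Ordinal an : path_graph n) \in interval a i by rewrite inE /=; lia.
  by exists (Ordinal an) => //; rewrite exponent_interval //=; lia.
apply: (fy_eq uS uE) => v vS; rewrite exponent_interval //=.
by move: vS; rewrite inE; lia.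
Qed.

(** Nothing lies outside, so the minimum is at the ends of the path, which have a single
    neighbor. *)
Lemma fy_interval_full : (1 < n)%N -> fy (interval 0 n) = n.+1.
Proof.
move=> n1; have n0 : (0 < n)%N by lia.
have aS : (Ordinal n0 : path_graph n) \in interval 0 n by rewrite inE /=; lia.
apply: (fy_eq aS) => [|v vS]; rewrite exponent_interval //=; first lia.
by have := ltn_ord v; lia.
Qed.

(** Connected sets are grouped by size [i]; those of a given size are indexed by their least element
    [a], at most [n - i]. *)
Lemma da_path_intervals : da (path_graph n) =
  \sum_(1 <= i < n.+1) \sum_(a < (n - i).+1) 'X^i * 'Y ^+ fy (interval a i).
Proof.
have lt_card (S : {set path_graph n}) : (#|S| < n.+1)%N.
  by rewrite ltnS -[leqRHS]card_ord max_card.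
rewrite /da (partition_big (fun S => Ordinal (lt_card S)) xpredT) //=.
rewrite -(big_mkord xpredT (fun i => \sum_(S : {set path_graph n} |
  ((S != set0) && connected (induced S)) && (#|S| == i)) 'X^#|S| * 'Y ^+ fy S)).
(* The size 0 term is an empty sum, the empty set being excluded. *)
rewrite big_ltn // big1 ?add0r => [|S]; last first.
  by rewrite cards_eq0 => /andP[/andP[/negP]].
apply: eq_big_nat => i /andP[i_gt0 i_le].
have eq_i (a : 'I_(n - i).+1) : (a + i <= n)%N by have := ltn_ord a; lia.
transitivity (\sum_(S in [set interval a i | a : 'I_(n - i).+1])
                 'X^i * 'Y ^+ fy S : {poly {poly int}}).
  apply: eq_big => [S|S /andP[_ /eqP -> //]].
  apply/andP/imsetP=> [[/andP[nS conS] /eqP Si]|[a _ ->]]; last first.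
    by rewrite connected_interval -card_gt0 card_interval // i_gt0.
  have [a] := connected_is_interval nS conS; rewrite Si => ain ->.
  have an : (a < (n - i).+1)%N by lia.
  by exists (Ordinal an).
(* Distinct starting points give distinct intervals: each starting point lies in both sets, whence
   [a <= b] and [b <= a]. *)
rewrite big_imset //= => a b _ _ /setP eq_ab; apply: ord_inj => /=.
have an : (a < n)%N by have := eq_i a; lia.
have bn : (b < n)%N by have := eq_i b; lia.
have := eq_ab (Ordinal an); have := eq_ab (Ordinal bn).
by rewrite !inE /=; lia.
Qed.

Definition path_da : {poly {poly int}} :=
  2%:R * 'X * 'Y ^+ (n - 1)%N
  + (n - 2)%N%:R * 'X * 'Y ^+ (n - 2)%N
  + 'Y ^+ n * (\sum_(2 <= i < n) (n - i + 1)%N%:R * 'X^i)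
  + 'X^n * 'Y ^+ (n + 1)%N.

Lemma da_path : (1 < n)%N -> da (path_graph n) = path_da.
Proof.
move=> n1; rewrite /path_da da_path_intervals big_ltn; last lia.
rewrite big_nat_recr //= subnn big_ord1 fy_interval_full // addrA addn1.
congr (_ + _ + _); last first.
  rewrite big_distrr /=; apply: eq_big_nat => i i2n.
  rewrite (eq_bigr (fun=> 'X^i * 'Y ^+ n)) => [|a _]; last first.
    by rewrite fy_interval //; have := ltn_ord a; lia.
  by rewrite sumr_const card_ord addn1 mulr_natl mulrnAr mulrC.
(* Among the singletons, the first and last terms are the two ends, of degree 1; the remaining
   [n - 2] vertices have degree 2. *)
rewrite (_ : (n - 1).+1 = (n - 2).+2)%N; last lia.
rewrite big_ord_recl big_ord_recr /= !fy_interval1; try (rewrite /bump; lia).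
rewrite (eq_bigr (fun=> 'X^1 * 'Y ^+ (n - 2))) => [|a _]; last first.
  have := ltn_ord a => ?.
  by rewrite fy_interval1 /= /bump; [congr (_ * _ ^+ _)|]; lia.
rewrite sumr_const card_ord expr1 -!mulrA !mulr_natl mulr2n.
rewrite addrCA addrC; congr (_ * _ ^+ _ + _ * _ ^+ _ + _); rewrite /bump; lia.
Qed.

End Path.

(** * Recognizing a path from its degrees *)

Section PathRecognition.
Variables (G : sgraph) (v0 : G).
Hypothesis connectedG : connected (induced [set: G]).
Hypothesis deg_v0 : #|[set v | adj v0 v]| = 1%N.
Hypothesis deg_le2 : forall u : G, (#|[set v | adj u v]| <= 2)%N.

(** The length is maximized over [nat]: length 0 is realized, and distinctness bounds every length
    by [#|G|]. Tuples make [P] decidable. *)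
Lemma exists_maximal_path :
  exists2 p : seq G, uniq (v0 :: p) && path (@adj G) v0 p &
    forall q : seq G, uniq (v0 :: q) && path (@adj G) v0 q -> (size q <= size p)%N.
Proof.
pose P m := [exists t : m.-tuple G, uniq (v0 :: t) && path (@adj G) v0 t].
have exP : exists m, P m by exists 0%N; apply/existsP; exists [tuple].
have P_seq (q : seq G) : uniq (v0 :: q) && path (@adj G) v0 q -> P (size q).
  by move=> pq; apply/existsP; exists (in_tuple q).
have leP m : P m -> (m <= #|G|)%N.
  case/existsP=> t /andP[/andP[_ uniq_t] _].
  by rewrite -(size_tuple t) -(card_uniqP uniq_t) max_card.
case: (ex_maxnP exP leP) => m /existsP[t pt] max_m.
by exists t => // q /P_seq/max_m; rewrite size_tuple.
Qed.

Lemma isomorphic_path_card : isomorphic G (path_graph #|G|).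
Proof.
have [p /andP[uniq_s path_p] max_p] := exists_maximal_path.
set s := v0 :: p in uniq_s.
pose x i := nth v0 s i.
have edge i : (i.+1 < size s)%N -> adj (x i) (x i.+1).
  by move=> lt_i; apply: (pathP v0 path_p).
have x_inj i j : (i < size s)%N -> (j < size s)%N -> x i = x j -> i = j.
  by move=> li lj /eqP; rewrite nth_uniq // => /eqP.
(* Before the last vertex, the path already uses up the degree: one neighbor at [v0], two at an
   inner vertex, where a third would contradict [deg_le2]. *)
have nbr i u : (i.+1 < size s)%N -> adj (x i) u ->
    u = x i.+1 \/ (0 < i)%N /\ u = x i.-1.
  case: i => [|i] lt_i iu.
    left; have /eqP/cards1P[y Ny] := deg_v0.
    have : u \in [set v | adj v0 v] by rewrite inE.
    have : x 1%N \in [set v | adj v0 v] by rewrite inE (edge 0%N).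
    by rewrite Ny !inE => /eqP-> /eqP.
  have [u_out|] := boolP (u \notin [set x i.+2; x i]); last first.
    by rewrite negbK !inE => /orP[] /eqP->; [left | right].
  have x_neq : x i.+2 != x i.
    by apply/eqP => /x_inj; lia.
  have := deg_le2 (x i.+1); rewrite leqNgt => /negP[].
  rewrite (_ : 3 = #|u |: [set x i.+2; x i]|)%N; last first.
    by rewrite cardsU1 u_out cards2 x_neq.
  apply/subset_leq_card/subsetP=> y; rewrite !inE => /or3P[] /eqP->//.
    exact: edge.
  by rewrite adj_sym edge //; lia.
(* By connectedness, it is enough that no edge leaves the path. *)
have s_all u : u \in s.
  move/connected_inducedP/(_ [set v in s]): connectedG => cutT.
  suff sT : [set v in s] = [set: G].
    by have := in_setT u; rewrite -sT inE.
  apply: cutT; first exact: subsetT.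
    by apply/set0Pn; exists v0; rewrite !inE eqxx.
  move=> y z; rewrite !inE -/s => ys _ yz; rewrite -!in_cons -/s in ys *.
  have idx_y : (index y s < size s)%N by rewrite index_mem.
  have yE : y = x (index y s) by rewrite /x nth_index.
  have [lt_y|] := ltnP (index y s).+1 (size s).
    rewrite yE in yz; have [->|[y_gt0 ->]] := nbr _ _ lt_y yz; apply: mem_nth => //.
    exact: leq_ltn_trans (leq_pred _) idx_y.
  (* Here [y] is the last vertex, so a neighbor [z] off the path would extend it, against
     maximality. *)
  move=> le_y; apply/negPn/negP => z_out.
  have last_p : last v0 p = y.
    by rewrite yE (last_nth v0) /x -/s; congr nth; move: idx_y le_y => /=; lia.
  suff /max_p : uniq (v0 :: rcons p z) && path (@adj G) v0 (rcons p z).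
    by rewrite size_rcons ltnn.
  by rewrite -rcons_cons rcons_uniq z_out uniq_s rcons_path path_p last_p.
have size_s : size s = #|G|.
  by rewrite -(card_uniqP uniq_s); apply: eq_card => u; rewrite s_all.
have lt_idx u : (index u s < #|G|)%N by rewrite -size_s index_mem.
(* There is no chord: by [nbr], the neighbors of [x i] are [x i.+1] and possibly [x i.-1], and
   [i.-1] cannot be [j] as [i < j]. *)
have adj_x i j : (i < j)%N -> (j < size s)%N -> adj (x i) (x j) = (i.+1 == j).
  move=> ij js; apply/idP/eqP=> [xij|<-]; last by apply: edge; lia.
  have [||/x_inj|[i_gt0 /x_inj]] // := nbr i (x j); first lia.
    by move=> -> //; lia.
  by move=> jE; have := jE; lia.
exists (fun u => Ordinal (lt_idx u) : path_graph #|G|); split.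
  apply: inj_card_bij; last by rewrite card_ord.
  by move=> u v [] /(congr1 x); rewrite /x !nth_index.
move=> u v.
rewrite -[LHS]/(((index u s).+1 == index v s) || ((index v s).+1 == index u s)).
have xu : x (index u s) = u by rewrite /x nth_index.
have xv : x (index v s) = v by rewrite /x nth_index.
have us : (index u s < size s)%N by rewrite index_mem.
have vs : (index v s < size s)%N by rewrite index_mem.
rewrite -[in RHS]xu -[in RHS]xv; move: us vs {xu xv}.
move: (index u s) (index v s) => i j si sj.
case: (ltngtP i j) => ij.
- by rewrite adj_x //; lia.
- by rewrite adj_sym adj_x //; lia.
- by rewrite ij adj_irr; lia.
Qed.

End PathRecognition.

(** * Reading the graph off the polynomial *)

Section PathPolynomial.
Variable n : nat.
Hypothesis n_gt1 : (1 < n)%N.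

(** Coefficients are taken in the outer variable x, so on the right ['X] stands for y. *)
Lemma coef_path_da k : (path_da n)`_k =
  (if k == 1%N then 'X^(n - 1) *+ 2 + 'X^(n - 2) *+ (n - 2) else 0)
  + (if (1 < k < n)%N then 'X^n *+ (n - k + 1) else 0)
  + (if k == n then 'X^(n + 1) else 0) :> {poly int}.
Proof.
have YE m : 'Y ^+ m = ('X^m)%:P :> {poly {poly int}} by rewrite rmorphXn.
rewrite /path_da !YE -!mulrA !mulr_natl !coefD !coefMn coefCM !coefMC coef_sum.
rewrite coefX coefXn; congr (_ + _ + _).
- by case: eqP => _; rewrite ?mul1r ?mul0r ?mul0rn ?addr0.
- under eq_bigr => i _ do rewrite mulr_natl coefMn coefXn.
  case: ifP => k1n.
    rewrite (bigD1_seq k) ?mem_index_iota ?iota_uniq //= eqxx big1 ?addr0.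
      by rewrite mulr_natr.
    by move=> i ik; rewrite eq_sym (negPf ik) mul0rn.
  rewrite big_nat big1 ?mulr0 // => i i2n.
  by case: eqP => [ki|]; rewrite ?mul0rn //; lia.
- by case: eqP => _; rewrite ?mul1r ?mul0r.
Qed.

Lemma isomorphic_of_da (G : sgraph) : da G = path_da n -> isomorphic G (path_graph n).
Proof.
move=> daG.
have degs : \sum_(u : G) 'X^(#|G| - #|[set v | adj u v]|)
            = 'X^(n - 1) *+ 2 + 'X^(n - 2) *+ (n - 2) :> {poly int}.
  rewrite -coef1_da daG coef_path_da eqxx /= addr0.
  by case: eqP => [n1|_]; [lia | rewrite addr0].
(* At y = 1 every vertex contributes 1 on the left, and the right is 2 + (n - 2). *)
have cardG : #|G| = n.
  have /(congr1 (fun q => q.[1])) := degs.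
  rewrite horner_sum hornerD !hornerMn !hornerXn !expr1n.
  under eq_bigr => u _ do rewrite hornerXn expr1n.
  by rewrite sumr_const -mulrnDr => /eqP; rewrite eqr_nat => /eqP ->; lia.
(* Only the full vertex set has size [n], so a nonzero coefficient of x^n means that it is
   connected. *)
have connG : connected (induced [set: G]).
  have : (da G)`_n != 0.
    rewrite daG coef_path_da eqxx ltnn andbF addr0 gtn_eqF // add0r.
    by rewrite -size_poly_gt0 size_polyXn.
  rewrite coef_da; apply: contraNT => not_conn; rewrite big1 // => S.
  case/and3P=> _ conS /eqP cardS; case/negP: not_conn.
  suff <- : S = setT by [].
  by apply/eqP; rewrite eqEcard subsetT cardsT cardG cardS /=.
(* The coefficient of y^k in [degs] counts the vertices of degree [n - k]. *)
have coef_degs k : (#|[set u : G | (n - #|[set v | adj u v]| == k)%N]|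
    = (n - 1 == k)%N.*2 + (n - 2 == k)%N * (n - 2))%N.
  have /(congr1 (fun q : {poly int} => q`_k)) := degs.
  rewrite coef_sum coefD !coefMn !coefXn cardG.
  under eq_bigr => u _ do rewrite coefXn eq_sym.
  rewrite -natr_sum -!mulrnA -natrD => /eqP; rewrite eqr_nat => /eqP eq_k.
  rewrite -sum1_card big_mkcond /= (eq_bigr (fun u : G =>
    (n - #|[set v | adj u v]| == k)%N : nat)) => [|u _].
    by rewrite eq_k -muln2 ![k == _]eq_sym.
  by rewrite inE; case: eqP.
(* Thanks to this bound the subtraction from [n] does not truncate, and degrees can be recovered
   from it. *)
have deg_le u : (#|[set v : G | adj u v]| <= n)%N by rewrite -cardG max_card.
have [v0 deg_v0] : exists v0 : G, #|[set v | adj v0 v]| = 1%N.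
  have : (0 < #|[set u : G | (n - #|[set v | adj u v]| == n - 1)%N]|)%N.
    by rewrite coef_degs eqxx.
  case/card_gt0P=> v0; rewrite inE => /eqP deg_v0; exists v0.
  by have := deg_le v0; lia.
rewrite -cardG; apply: (isomorphic_path_card connG deg_v0) => u.
(* The vertex [u] itself is counted, so its exponent is [n - 1] or [n - 2], that is, its degree is 1
   or 2. *)
have : (0 < #|[set w : G |
          (n - #|[set v | adj w v]| == n - #|[set v | adj u v]|)%N]|)%N.
  by apply/card_gt0P; exists u; rewrite inE.
by rewrite coef_degs; have := deg_le u; lia.
Qed.

End PathPolynomial.

Theorem proposition16 (n : nat) (hn : (2 <= n)%N) (G : sgraph)
    (hG : (0 < #|G|)%N) :
  isomorphic G (path_graph n) <->
  da G = 2%:R * 'X * 'Y ^+ (n - 1)%N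
         + (n - 2)%N%:R * 'X * 'Y ^+ (n - 2)%N
         + 'Y ^+ n * (\sum_(2 <= i < n) (n - i + 1)%N%:R * 'X^i)
         + 'X^n * 'Y ^+ (n + 1)%N.
Proof.
split; last exact: isomorphic_of_da.
by move=> isoG; rewrite (da_isomorphic isoG) da_path.
Qed.
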